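(* Let $X$ and $Y$ be compact Hausdorff spaces, let $i: C(X)\to C(Y)$ be a unital injective $*$-homomorphism, and let $p=i^*: Y\to X$ be its Gelfand dual, i.e. the continuous surjection with $i(\xi)=\xi\circ p$ for all $\xi\in C(X)$. Consider $C(Y)$ as a $C(X)$-module via $(f\xi)(y)=f(y)\,\xi(p(y))$ for $f\in C(Y)$, $\xi\in C(X)$. Then the following properties are equivalent: 1) The surjection $p$ is a finite-fold covering. 2) The $C(X)$-module $C(Y)$ may be equipped with a $C(X)$-valued inner product, compatible with the module structure $(f\xi)(y)=f(y)\,\xi(p(y))$, in such a way that it becomes a finitely generated projective Hilbert $C(X)$-module. 3) There exists a positive unital conditional expectation $E: C(Y)\to C(X)$ that is algebraically of index-finite type.
   Context: $C(Z)$ denotes the $C^*$-algebra of continuous complex-valued functions on a compact Hausdorff space $Z$. Finite-fold covering: a covering map with finite fibres, i.e. every $x\in X$ has an open neighborhood $U$ such that $p^{-1}(U)$ is a disjoint union of finitely many open sets each mapped homeomorphically onto $U$ by $p$ (the number of sheets is locally constant; it is not required to be globally constant if $X$ is disconnected). Hilbert module: a Hilbert $A$-module over a $C^*$-algebra $A$ is a (right) $A$-module $M$ with an $A$-valued inner product $\langle\cdot,\cdot\rangle$ (conjugate-linear in the first variable, $\langle f,g\xi\rangle=\langle f,g\rangle\xi$, $\langle f,g\rangle^*=\langle g,f\rangle$, $\langle f,f\rangle\ge 0$, and $\langle f,f\rangle=0$ only for $f=0$) that is complete in the norm $\|\langle f,f\rangle\|^{1/2}$. It is finitely generated projective if it is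 a direct summand of $A^n$ for some $n$. Conditional expectation: for a unital inclusion $i:A\hookrightarrow B$ of $C^*$-algebras, a conditional expectation $E:B\to A$ is a surjective linear projection of norm one with $E(i(a)b)=aE(b)$, $E(b\,i(a))=E(b)a$, $E(i(a))=a$ for $a\in A$, $b\in B$. It is positive if $E(b^*b)\ge 0$ for all $b\in B$, and unital if $i$ is unital. It is algebraically of index-finite type if there is a finite quasi-basis, i.e. a finite family $u_1,\dots,u_n\in B$ with $b=\sum_j u_j\, i(E(u_j^*b))$ for all $b\in B$. *)

(* Defs.v *)
From HB Require Import structures.
From mathcomp Require Import all_boot all_order all_algebra complex.
From mathcomp Require Import all_classical all_reals topology normedtype.

Set Implicit Arguments.
Unset Strict Implicit.
Unset Printing Implicit Defensive.
Import Order.TTheory GRing.Theory Num.Theory numFieldNormedType.Exports.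
Local Open Scope classical_set_scope.
Local Open Scope ring_scope.

(* The cast makes the modulus topology of mathcomp-analysis, which is attached
   to abstract numeric fields, available on R[i]. *)
Definition cfun (R : realType) (Z : topologicalType) : Type :=
  continuousType Z (complex R : numClosedFieldType).

HB.instance Definition _ (R : realType) (Z : topologicalType) :=
  Choice.copy (cfun R Z)
    (continuousType Z (complex R : numClosedFieldType)).

Section CfunAlgebra.
Context (R : realType) (Z : topologicalType).
Local Notation C := (complex R : numClosedFieldType).
Implicit Types (f g h : cfun R Z) (c : C).

Definition cfun_of (f : Z -> C) (cf : continuous f) : cfun R Z := mkcts cf.

Lemma cfunP f g : (forall z, f z = g z) -> f = g.
Proof. by move=> fg; apply/continuousEP. Qed.

Lemma cfun_cst_cts c : continuous (fun _ : Z => c).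
Proof. by move=> z; exact: cvg_cst. Qed.

Lemma cfun_add_cts f g : continuous (fun z => f z + g z).
Proof. by move=> z; apply: cvgD; exact: cts_fun. Qed.

Lemma cfun_opp_cts f : continuous (fun z => - f z).
Proof. by move=> z; apply: cvgN; exact: cts_fun. Qed.

Lemma cfun_mul_cts f g : continuous (fun z => f z * g z).
Proof. by move=> z; apply: cvgM; exact: cts_fun. Qed.

Lemma cfun_conj_cts f : continuous (fun z => (f z)^*).
Proof.
move=> z; apply/cvgrPdist_lt => e e0.
have /cvgrPdist_lt/(_ e e0) := @cts_fun _ _ f z.
by apply: filterS => y; rewrite -rmorphB norm_conjC.
Qed.

Definition cfun_cst c := cfun_of (@cfun_cst_cts c).
Definition cfun_add f g := cfun_of (@cfun_add_cts f g).
Definition cfun_opp f := cfun_of (@cfun_opp_cts f).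
Definition cfun_mul f g := cfun_of (@cfun_mul_cts f g).
Definition cfun_star f := cfun_of (@cfun_conj_cts f).

Lemma cfun_addA : associative cfun_add.
Proof. by move=> f g h; apply: cfunP => z /=; exact: addrA. Qed.
Lemma cfun_addC : commutative cfun_add.
Proof. by move=> f g; apply: cfunP => z /=; exact: addrC. Qed.
Lemma cfun_add0 : left_id (cfun_cst 0) cfun_add.
Proof. by move=> f; apply: cfunP => z /=; exact: add0r. Qed.
Lemma cfun_addN : left_inverse (cfun_cst 0) cfun_opp cfun_add.
Proof. by move=> f; apply: cfunP => z /=; exact: addNr. Qed.

HB.instance Definition _ :=
  GRing.isZmodule.Build (cfun R Z) cfun_addA cfun_addC cfun_add0 cfun_addN.

Lemma cfun_mulA : associative cfun_mul.
Proof. by move=> f g h; apply: cfunP => z /=; exact: mulrA. Qed.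
Lemma cfun_mulC : commutative cfun_mul.
Proof. by move=> f g; apply: cfunP => z /=; exact: mulrC. Qed.
Lemma cfun_mul1 : left_id (cfun_cst 1) cfun_mul.
Proof. by move=> f; apply: cfunP => z /=; exact: mul1r. Qed.
Lemma cfun_mulDl : left_distributive cfun_mul +%R.
Proof. by move=> f g h; apply: cfunP => z /=; exact: mulrDl. Qed.

(* Only a "pz" ring, since C(Z) is the zero ring when Z is empty. *)
HB.instance Definition _ :=
  GRing.Zmodule_isComPzRing.Build (cfun R Z)
    cfun_mulA cfun_mulC cfun_mul1 cfun_mulDl.

Definition cfun_scale c f := cfun_mul (cfun_cst c) f.

Lemma cfun_scaleA a b f : cfun_scale a (cfun_scale b f) = cfun_scale (a * b) f.
Proof. by apply: cfunP => z /=; exact: mulrA. Qed.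
Lemma cfun_scale1 : left_id 1 cfun_scale.
Proof. by move=> f; apply: cfunP => z /=; exact: mul1r. Qed.
Lemma cfun_scaleDr : right_distributive cfun_scale +%R.
Proof. by move=> c f g; apply: cfunP => z /=; exact: mulrDr. Qed.
Lemma cfun_scaleDl f : {morph cfun_scale^~ f : a b / a + b}.
Proof. by move=> a b; apply: cfunP => z /=; exact: mulrDl. Qed.

HB.instance Definition _ :=
  GRing.Zmodule_isLmodule.Build (complex R) (cfun R Z)
    cfun_scaleA cfun_scale1 cfun_scaleDr cfun_scaleDl.

Definition cfun_ge0 f : Prop := forall z, 0 <= f z.

Definition cfun_norm f : R := sup (range (fun z => complex.Re `|f z|)).

End CfunAlgebra.

(* A copy of C(Y), indexed by p, which carries the C(X)-module structure. *)
Definition pullback_module (R : realType) (X Y : topologicalType)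
  (p : continuousType Y X) : Type := cfun R Y.
Arguments pullback_module R {X Y} p.

Section PullbackModule.
Context (R : realType) (X Y : topologicalType) (p : continuousType Y X).
Local Notation M := (pullback_module R p).

HB.instance Definition _ := GRing.Zmodule.copy M (cfun R Y).

Implicit Types (f g : M) (xi : cfun R X).

Lemma pullback_cts xi : continuous (fun y => xi (p y)).
Proof. by move=> y; apply: continuous_comp; exact: cts_fun. Qed.

Definition pullback_act xi f : M :=
  (f : cfun R Y) * cfun_of (@pullback_cts xi).

Lemma pullback_actA a b f :
  pullback_act a (pullback_act b f) = pullback_act (a * b) f.
Proof.
by apply: cfunP => y; rewrite (mulrC a b); exact: (esym (mulrA _ _ _)).
Qed.
Lemma pullback_act1 : left_id 1 pullback_act.
Proof. by move=> f; apply: cfunP => y /=; exact: mulr1. Qed.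
Lemma pullback_actDr : right_distributive pullback_act +%R.
Proof. by move=> a f g; apply: cfunP => y /=; exact: mulrDl. Qed.
Lemma pullback_actDl f : {morph pullback_act^~ f : a b / a + b}.
Proof. by move=> a b; apply: cfunP => y /=; exact: mulrDr. Qed.

(* C(X) is commutative, so the right action f xi is the scaling xi *: f. *)
HB.instance Definition _ :=
  GRing.Zmodule_isLmodule.Build (cfun R X) M
    pullback_actA pullback_act1 pullback_actDr pullback_actDl.

End PullbackModule.

Definition homeomorphic_via (Y X : topologicalType) (p : Y -> X)
    (V : set Y) (U : set X) : Prop :=
  exists q : X -> Y,
    [/\ set_fun V U p /\ set_fun U V q,
        {in V, cancel p q} /\ {in U, cancel q p},
        {within V, continuous p} & {within U, continuous q}].

Definition finite_fold_covering (Y X : topologicalType) (p : Y -> X) : Prop :=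
  forall x : X, exists U : set X,
    [/\ open U, U x &
      exists (n : nat) (V : 'I_n -> set Y),
        [/\ forall k, open (V k), trivIset [set: 'I_n] V,
            p @^-1` U = \bigcup_k V k &
            forall k, homeomorphic_via p (V k) U]].

Section HilbertModule.
Context (R : realType) (X : topologicalType) (M : lmodType (cfun R X)).
Implicit Types (ip : M -> M -> cfun R X) (f g h : M) (xi : cfun R X).

Definition hilbert_norm ip f : R := Num.sqrt (cfun_norm (ip f f)).

Definition hilbert_complete ip : Prop :=
  forall u : nat -> M,
    (forall e : R, 0 < e -> exists N : nat, forall m n : nat,
       (N <= m)%N -> (N <= n)%N -> hilbert_norm ip (u m - u n) < e) ->
    exists l : M, forall e : R, 0 < e -> exists N : nat, forall n : nat,
       (N <= n)%N -> hilbert_norm ip (u n - l) < e.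

(* Complex scalars act on M through the constant functions. *)
Record is_hilbert_module ip : Prop := IsHilbertModule {
  ip_conj_linear : forall (c : complex R) f g h,
    ip (cfun_cst X c *: f + g) h = c^* *: ip f h + ip g h;
  ip_act : forall f g xi, ip f (xi *: g) = ip f g * xi;
  ip_star : forall f g, cfun_star (ip f g) = ip g f;
  ip_ge0 : forall f, cfun_ge0 (ip f f);
  ip_definite : forall f, ip f f = 0 -> f = 0;
  ip_complete : hilbert_complete ip }.

Definition fin_gen_projective : Prop :=
  exists (n : nat) (N : lmodType (cfun R X))
    (phi : {linear (M * N)%type -> 'rV[cfun R X]_n}), bijective phi.

End HilbertModule.

Section ConditionalExpectation.
Context (R : realType) (X Y : topologicalType).
Implicit Types (i : cfun R X -> cfun R Y) (E : cfun R Y -> cfun R X).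

Definition op_norm E : R :=
  sup [set cfun_norm (E b) | b in [set b | cfun_norm b <= 1]].

(* The norm condition is restricted to X nonempty because every operator into
   the zero algebra C(X) of the empty space has norm 0. *)
Record is_cond_exp i E : Prop := IsCondExp {
  ce_linear : linear E;
  ce_surj : forall a, exists b, E b = a;
  ce_norm : [set: X] !=set0 -> op_norm E = 1;
  ce_modl : forall a b, E (i a * b) = a * E b;
  ce_modr : forall a b, E (b * i a) = E b * a;
  ce_proj : forall a, E (i a) = a }.

Definition positive_map E : Prop :=
  forall b, cfun_ge0 (E (cfun_star b * b)).

Definition index_finite i E : Prop :=
  exists (n : nat) (u : 'I_n -> cfun R Y),
    forall b, b = \sum_j u j * i (E (cfun_star (u j) * b)).

End ConditionalExpectation.

(* Main.v *)
(* Both a finitely generated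
   projective structure and a quasi-basis provide a dual basis: functions [u_j]
   on Y and C(X)-linear maps [al_j : C(Y) -> C(X)] with
   [f = \sum_j u_j (al_j f \o p)].  A function vanishing on the fibre over [x] is
   [c (xi \o p)] with [xi x = 0], so [al_j f x] depends only on [f] on that fibre;
   hence fibres have at most [n] points, and the trace [\sum_j al_j (f u_j)] of
   multiplication by [f] is the sum of [f] over the fibre.  So fibre sums of
   continuous functions are continuous.  Applied to [1] this makes the cardinality
   of the fibre locally constant, applied to bump functions it makes [p] open, and
   an open map with finite fibres of locally constant cardinality is a covering.
   Conversely, for a covering, the mean over the fibre is the conditional
   expectation and the fibre sum of [f^* g] is the inner product. *)
Require Import Defs.
From HB Require Import structures.
From mathcomp Require Import all_boot all_order all_algebra complex.
From mathcomp Require Import all_classical all_reals topology normedtype.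
Import Order.TTheory GRing.Theory Num.Theory numFieldNormedType.Exports.
Local Open Scope classical_set_scope.
Local Open Scope ring_scope.
From mathcomp Require Import realfun lra.
Set Implicit Arguments.
Unset Strict Implicit.
Unset Printing Implicit Defensive.

(** * The complex modulus as a real number, and continuity between R and C *)

Section ComplexModulus.
Context (R : realType).
Local Notation C := (complex R : numClosedFieldType).

(** The norm [|x|] has values in [C]; this is the same number in [R], where suprema and real-valued
    continuity are available. *)
Definition cmod (x : C) : R := complex.Re `|x|.

Lemma cmodE (x : C) : `|x| = (cmod x)%:C%C.
Proof. by rewrite /cmod RRe_real// normr_real. Qed.

Lemma cmod_ge0 (x : C) : 0 <= cmod x.
Proof. by rewrite -ler0c -cmodE. Qed.

Lemma cmodM (x y : C) : cmod (x * y) = cmod x * cmod y.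
Proof. by apply: complexI; rewrite rmorphM -!cmodE normrM. Qed.

Lemma cmodD (x y : C) : cmod (x + y) <= cmod x + cmod y.
Proof. by rewrite -lecR rmorphD -!cmodE ler_normD. Qed.

Lemma cmodB (x y : C) : cmod (x - y) = cmod (y - x).
Proof. by rewrite /cmod distrC. Qed.

Lemma cmod_eq0 (x : C) : (cmod x == 0) = (x == 0).
Proof. by rewrite -(inj_eq (@complexI R)) -cmodE normr_eq0. Qed.

Lemma cmod0 : cmod 0 = 0.
Proof. by apply/eqP; rewrite cmod_eq0. Qed.

Lemma norm_real_complex (x : R) : `|(x%:C%C : C)| = `|x|%:C%C.
Proof. by rewrite normc_def/= expr0n/= addr0 sqrtr_sqr. Qed.

Lemma continuous_complex (Z : topologicalType) (f : Z -> R) :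
  continuous f -> continuous (fun z => (f z)%:C%C : C).
Proof.
move=> cf z; apply/cvgrPdist_lt => e e0.
have e0' : 0 < complex.Re e by move: e0; rewrite ltcE => /andP[].
have /cvgrPdist_lt/(_ _ e0') := cf z.
apply: filterS => y; rewrite -rmorphB norm_real_complex => h.
by rewrite -(RRe_real (gtr0_real e0)) ltcR.
Qed.

Lemma continuous_Re (Z : topologicalType) (f : Z -> C) :
  continuous f -> continuous (fun z => complex.Re (f z)).
Proof.
move=> cf z; apply/cvgrPdist_lt => e e0.
have e0' : 0 < (e%:C%C : C) by rewrite ltcR.
have /cvgrPdist_lt/(_ _ e0') := cf z.
apply: filterS => y h.
rewrite -ltcR; apply: le_lt_trans h.
by rewrite -raddfB; apply: normc_ge_Re.
Qed.

Lemma normi_complex : `|('i%C : C)| = 1.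
Proof. by rewrite normc_def/= expr0n/= expr1n add0r sqrtr1. Qed.

Lemma normc_ge_Im (x : C) : `|complex.Im x|%:C%C <= `|x|.
Proof.
have := normc_ge_Re (x * 'i%C).
by rewrite ReiNIm normrN normrM normi_complex mulr1.
Qed.

End ComplexModulus.

(** * Sup norm, Urysohn functions and completeness of C(Z) *)

Section ContinuousFunctions.
Context (R : realType) (Z : topologicalType).
Local Notation C := (complex R : numClosedFieldType).

Lemma continuous_cmod (f : Z -> C) :
  continuous f -> continuous (fun z => cmod (f z)).
Proof.
move=> cf; apply: continuous_Re => z.
by apply: continuous_comp; [exact: cf|exact: norm_continuous].
Qed.

Lemma sum_cfunE (I : Type) (r : seq I) (P : pred I) (F : I -> cfun R Z) z :
  (\sum_(i <- r | P i) F i) z = \sum_(i <- r | P i) F i z.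
Proof. exact: (big_morph (fun f : cfun R Z => f z)). Qed.

Lemma cfun_has_ubound (f : cfun R Z) : compact [set: Z] ->
  has_ubound (range (fun z => cmod (f z))).
Proof.
move=> cZ.
have /compact_bounded[M [_ /(_ (M + 1))]] :
    compact (range (fun z => cmod (f z))).
  apply: continuous_compact => //; apply: continuous_subspaceT.
  by apply: continuous_cmod; exact: cts_fun.
rewrite ltrDl ltr01 => /(_ isT) HM.
by exists (M + 1) => x xr; rewrite (le_trans (ler_norm _))//; exact: HM.
Qed.

Lemma cfun_norm_ub (f : cfun R Z) z : compact [set: Z] ->
  `|f z| <= (cfun_norm f)%:C%C.
Proof.
move=> cZ; rewrite cmodE lecR; apply: ub_le_sup; first exact: cfun_has_ubound.
by exists z.
Qed.

Lemma cfun_norm_le (f : cfun R Z) (M : R) : 0 <= M ->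
  (forall z, `|f z| <= M%:C%C) -> cfun_norm f <= M.
Proof.
move=> M0 fM; have [[z _]|Z0] := pselect ([set: Z] !=set0).
  apply: ge_sup; first by exists (cmod (f z)), z.
  by move=> _ [y _ <-]; rewrite -lecR -cmodE.
(* For empty [Z] the norm is the supremum of the empty set, which is 0 by convention; here [0 <= M]
   is used. *)
rewrite /cfun_norm.
have -> : range (fun z => complex.Re `|f z|) = set0.
  by rewrite -subset0 => t [y _ _] /=; apply: Z0; exists y.
by rewrite sup0.
Qed.

Lemma urysohn_cfun (A B : set Z) :
  compact [set: Z] -> hausdorff_space Z -> closed A -> closed B ->
  A `&` B = set0 ->
  exists h : cfun R Z, [/\ forall z, 0 <= h z <= 1,
    forall z, A z -> h z = 0 & forall z, B z -> h z = 1].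
Proof.
move=> cZ hZ cA cB AB.
have nZ := compact_normal hZ cZ.
have /(uniform_separatorP (R := R))[f [cf f01 f0 f1]] :=
  (@normal_separatorP R Z).1 nZ _ _ cA cB AB.
exists (cfun_of (continuous_complex cf)); split => z /=.
- have /= := f01 (f z); rewrite in_itv/= => /(_ (ex_intro2 _ _ z I erefl)).
  by move=> /andP[? ?]; rewrite ler0c lecR/= => *; apply/andP.
- move=> Az; have fz : f z = 0 by apply: f0; exists z.
  by congr (_%:C%C).
- move=> Bz; have fz : f z = 1 by apply: f1; exists z.
  by congr (_%:C%C).
Qed.

Lemma bump_cfun (z0 : Z) (U : set Z) :
  compact [set: Z] -> hausdorff_space Z -> open U -> U z0 ->
  exists h : cfun R Z, [/\ forall z, 0 <= h z <= 1,
    forall z, ~ U z -> h z = 0 & h z0 = 1].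
Proof.
move=> cZ hZ oU Uz.
have [|||h [h01 h0 h1]] := @urysohn_cfun (~` U) [set z0] cZ hZ.
- exact: open_closedC.
- by apply: accessible_closed_set1; exact: hausdorff_accessible.
- by rewrite -subset0 => z [/= nU zE]; apply: nU; rewrite zE.
- by exists h; split => //; exact: h1.
Qed.

Lemma real_complete (v : nat -> R) :
  (forall e : R, 0 < e -> exists N : nat, forall m n : nat,
     (N <= m)%N -> (N <= n)%N -> `|v m - v n| <= e) ->
  exists l : R, forall e : R, 0 < e -> exists N : nat, forall n : nat,
     (N <= n)%N -> `|v n - l| <= e.
Proof.
move=> vC.
have /cauchy_cvgP/cvg_ex[l vl] : cauchy (v @ \oo).
  apply: cauchy_exP => e e0.
  have [N HN] := vC (e / 2) (divr_gt0 e0 (ltr0n _ 2)).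
  exists (v N), N => // n /= Nn; rewrite /ball/=.
  by rewrite (le_lt_trans (HN _ _ (leqnn N) Nn))// ltr_pdivrMr// ltr_pMr// ltr1n.
exists l => e e0; have /cvgrPdist_le/(_ e e0)[N _ HN] := vl.
by exists N => n /HN; rewrite distrC.
Qed.

Lemma complex_complete (v : nat -> C) :
  (forall e : R, 0 < e -> exists N : nat, forall m n : nat,
     (N <= m)%N -> (N <= n)%N -> `|v m - v n| <= e%:C%C) ->
  exists l : C, forall e : R, 0 < e -> exists N : nat, forall n : nat,
     (N <= n)%N -> `|v n - l| <= e%:C%C.
Proof.
move=> vC.
have [|a Ha] := @real_complete (fun n => complex.Re (v n)).
  move=> e /vC[N HN]; exists N => m n Nm Nn.
  by rewrite -lecR -raddfB (le_trans (normc_ge_Re _))//; exact: HN.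
have [|b Hb] := @real_complete (fun n => complex.Im (v n)).
  move=> e /vC[N HN]; exists N => m n Nm Nn.
  by rewrite -lecR -raddfB (le_trans (normc_ge_Im _))//; exact: HN.
exists (a +i* b)%C => e e0.
have e2 : 0 < e / 2 by rewrite divr_gt0.
have [[N HN] [M HM]] := (Ha _ e2, Hb _ e2).
exists (maxn N M) => n; rewrite geq_max => /andP[/HN ha /HM hb].
rewrite [v n - _]complexE (le_trans (ler_normD _ _))// normrM.
rewrite normi_complex mul1r !norm_real_complex -rmorphD lecR [leRHS]splitr.
by move: (v n) ha hb => [x y] /= ha hb; exact: lerD.
Qed.

(** Pointwise limits exist by completeness of C; the uniform Cauchy condition makes the convergence
    uniform, and a three-term estimate then gives continuity of the limit. *)
Lemma cfun_complete (u : nat -> cfun R Z) :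
  (forall e : R, 0 < e -> exists N : nat, forall m n : nat,
     (N <= m)%N -> (N <= n)%N -> forall z, `|u m z - u n z| <= e%:C%C) ->
  exists l : cfun R Z, forall e : R, 0 < e -> exists N : nat, forall n : nat,
     (N <= n)%N -> forall z, `|u n z - l z| <= e%:C%C.
Proof.
move=> uC.
have /choice[l Hl] (z : Z) : exists l : C, forall e : R, 0 < e ->
    exists N : nat, forall n : nat, (N <= n)%N -> `|u n z - l| <= e%:C%C.
  apply: complex_complete => e /uC[N HN].
  by exists N => m n Nm Nn; exact: HN.
have ul (e : R) : 0 < e -> exists N : nat, forall n : nat,
     (N <= n)%N -> forall z, `|u n z - l z| <= e%:C%C.
  move=> e0; have e2 : 0 < e / 2 by rewrite divr_gt0.
  have [N HN] := uC _ e2; exists N => n Nn z.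
  (* [M] depends on [z], but it only selects an intermediate index: the final bound involves the
     uniform [N] alone. *)
  have [M HM] := Hl z _ e2.
  rewrite -(subrKA (u (maxn N M) z)) (le_trans (ler_normD _ _))//.
  rewrite [e]splitr rmorphD lerD//.
    by apply: HN => //; exact: leq_maxl.
  by apply: HM; exact: leq_maxr.
suff cl : continuous l by exists (cfun_of cl).
move=> z; apply/cvgrPdist_le => e e0.
rewrite -(RRe_real (gtr0_real e0)); move: e0; rewrite ltcE => /andP[_ /=].
move: (complex.Re e) => r r0.
have r3 : 0 < r / 3 by rewrite divr_gt0.
have [N /(_ N (leqnn N)) HN] := ul _ r3.
have r3' : 0 < ((r / 3)%:C%C : C) by rewrite ltcR.
have /cvgrPdist_le/(_ _ r3') := @cts_fun _ _ (u N) z.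
apply: filterS => y Hy.
rewrite -(subrKA (u N z)) (le_trans (ler_normD _ _))//.
rewrite -[X in _ + `|X|](subrKA (u N y)).
apply: (@le_trans _ _ ((r / 3)%:C%C + ((r / 3)%:C%C + (r / 3)%:C%C))).
  apply: lerD; first by rewrite distrC; exact: HN.
  by rewrite (le_trans (ler_normD _ _))// lerD//; exact: HN.
by rewrite -!rmorphD lecR; lra.
Qed.

End ContinuousFunctions.

(** * Factoring a function that vanishes on a fibre through a function on X *)

Section Factorization.
Context (R : realType) (X Y : topologicalType) (p : continuousType Y X).
Hypotheses (cX : compact [set: X]) (hX : hausdorff_space X).
Hypothesis (cY : compact [set: Y]).
Local Notation C := (complex R : numClosedFieldType).

Lemma half_exp_small (e : R) : 0 < e -> exists N : nat, 2 * 2^-1 ^+ N <= e.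
Proof.
move=> e0; exists (Num.bound (2 / e)).
have b0 : 0 <= 2 / e by rewrite divr_ge0// ltW.
have := archi_boundP b0; set n := Num.bound _.
rewrite ltr_pdivrMr// => /ltW h; rewrite exprVn ler_pdivrMr ?exprn_gt0//.
rewrite (le_trans h)// mulrC ler_pM2l// -natrX ler_nat.
by rewrite ltnW// ltn_expl.
Qed.

(** Take [xi] to be the sum of [2^-k h_k], with [h_k] a Urysohn function equal to 0 at [x] and to 1
    on [F k]. The series converges uniformly, and since its terms are nonnegative each one bounds
    the sum from below. *)
Lemma summable_urysohn (F : nat -> set X) (x : X) :
  (forall k, closed (F k)) -> (forall k, ~ F k x) ->
  exists xi : cfun R X, xi x = 0 /\
    forall k z, F k z -> 2^-1 ^+ k <= cmod (xi z).
Proof.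
move=> cF Fx.
have /choice[h Hh] (k : nat) : exists h : cfun R X,
    [/\ forall z, 0 <= h z <= 1, h x = 0 & forall z, F k z -> h z = 1].
  have [|//||h [h01 h0 h1]] := @urysohn_cfun R X [set x] (F k) cX hX.
  - by apply: accessible_closed_set1; exact: hausdorff_accessible.
  - by rewrite -subset0 => z [/= ->]; exact: Fx.
  - by exists h; split => //; exact: h0.
pose s n : cfun R X := \sum_(k < n) (2^-1 ^+ k : C) *: h k.
have sS n z : s n.+1 z = s n z + 2^-1 ^+ n * h n z.
  by rewrite /s big_ord_recr.
have sx n : s n x = 0.
  elim: n => [|n IH]; first by rewrite /s big_ord0.
  by rewrite sS IH; case: (Hh n) => _ -> _; rewrite mulr0 addr0.
(* The upper bound is the geometric sum of [2^-k] over [m <= k < n]. *)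
have s_bound m n z : (m <= n)%N ->
    0 <= s n z - s m z <= 2 * 2^-1 ^+ m - 2 * 2^-1 ^+ n.
  elim: n => [|n IH].
    by rewrite leqn0 => /eqP ->; rewrite !subrr lexx.
  rewrite leq_eqVlt ltnS => /predU1P[->|/IH /andP[l0 l1]].
    by rewrite !subrr lexx.
  have p0 : 0 <= (2^-1 ^+ n : C) by rewrite exprn_ge0// invr_ge0.
  have [/(_ z)/andP[a0 a1] _ _] := Hh n.
  rewrite sS addrAC addr_ge0 ?mulr_ge0//=.
  have -> : 2 * 2^-1 ^+ m - 2 * 2^-1 ^+ n.+1 =
      2 * 2^-1 ^+ m - 2 * 2^-1 ^+ n + 2^-1 ^+ n :> C.
    rewrite exprS mulrA divff ?pnatr_eq0// mul1r -addrA; congr (_ + _).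
    by rewrite mulr2n mulrDl mul1r opprD addrNK.
  by rewrite lerD// ler_piMr.
have s_cauchy m n z : (m <= n)%N -> cmod (s n z - s m z) <= 2 * 2^-1 ^+ m.
  move=> /s_bound -/(_ z)/andP[l0 l1]; rewrite -lecR -cmodE ger0_norm//.
  rewrite (le_trans l1)// rmorphM rmorphXn fmorphV rmorph_nat.
  by rewrite gerBl mulr_ge0// exprn_ge0// invr_ge0.
have [|xi Hxi] := @cfun_complete R X s.
  move=> e /half_exp_small[N HN]; exists N => m n Nm Nn z.
  rewrite cmodE lecR; have [mn|/ltnW nm] := leqP m n.
    rewrite cmodB (le_trans (s_cauchy _ _ _ mn))// (le_trans _ HN)//.
    by rewrite ler_pM2l// ler_wiXn2l// ?invr_ge0// invf_le1// ler1n.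
  rewrite (le_trans (s_cauchy _ _ _ nm))// (le_trans _ HN)//.
  by rewrite ler_pM2l// ler_wiXn2l// ?invr_ge0// invf_le1// ler1n.
exists xi; split.
  apply/eqP; rewrite -cmod_eq0 eq_le cmod_ge0 andbT.
  apply/ler_addgt0Pr => e /Hxi[N /(_ N (leqnn N) x)].
  by rewrite sx sub0r normrN cmodE lecR add0r.
move=> k z Fz; apply/ler_addgt0Pr => e /Hxi[N HN].
(* [s k.+1] is the first partial sum that contains the term with [h k]. *)
have {HN} := HN (maxn N k.+1) (leq_maxl _ _) z; set n := maxn _ _ => HN.
have kn : (k.+1 <= n)%N := leq_maxr _ _.
have s0 : 0 <= s k z.
  have /andP[] := s_bound 0%N k z (leq0n k).
  by rewrite /s big_ord0 subr0.
have : 2^-1 ^+ k <= s n z.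
  have /andP[+ _] := s_bound _ _ z kn; rewrite subr_ge0; apply: le_trans.
  by rewrite sS; case: (Hh k) => _ _ ->//; rewrite mulr1 lerDr.
move=> ks; have : 2^-1 ^+ k <= cmod (s n z).
  rewrite -lecR -cmodE rmorphXn fmorphV rmorph_nat ger0_norm//.
  by rewrite (le_trans _ ks)// exprn_ge0// invr_ge0.
move=> /le_trans; apply.
rewrite -[s n z](subrK (xi z)) (le_trans (cmodD _ _))// addrC lerD2l.
by rewrite -lecR -cmodE.
Qed.

(* [xi] is built so that [|b y| <= 4 |xi (p y)|^2] wherever [|b y| < 1];
   the quotient [b / (xi \o p)], which is [0] where the denominator vanishes,
   is therefore continuous. *)
Lemma factor_vanishing (b : cfun R Y) (x : X) :
  (forall y, p y = x -> b y = 0) ->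
  exists (xi : cfun R X) (c : cfun R Y),
    xi x = 0 /\ forall y, b y = c y * xi (p y).
Proof.
move=> bx.
pose F k := p @` [set y | 4^-1 ^+ k <= cmod (b y)].
have [|k [y /= + /bx by0]|xi [xi0 Fxi]] := @summable_urysohn F x.
- move=> k; apply: compact_closed => //; apply: continuous_compact.
    by apply: continuous_subspaceT; exact: cts_fun.
  apply: (subclosed_compact _ cY) => //.
  apply: (@preimage_closed _ _ _ [set r : R | 4^-1 ^+ k <= r]); last exact: closed_ge.
  by move=> y _; apply: continuous_cmod; exact: cts_fun.
- by rewrite by0 cmod0 leNgt exprn_gt0// invr_gt0.
have quarter k : 4^-1 ^+ k = (2^-1 ^+ k) ^+ 2 :> R.
  by rewrite exprAC; congr (_ ^+ _); rewrite exprVn -natrX.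
have b_le y : cmod (b y) < 1 -> cmod (b y) <= 4 * cmod (xi (p y)) ^+ 2.
  have [->|b0] := eqVneq (b y) 0.
    by rewrite cmod0 mulr_ge0// exprn_ge0// cmod_ge0.
  have bp : 0 < cmod (b y) by rewrite lt_def cmod_eq0 b0 cmod_ge0.
  have : exists k, 4^-1 ^+ k <= cmod (b y).
    have [N HN] := half_exp_small bp; exists N; rewrite (le_trans _ HN)//.
    rewrite (@le_trans _ _ (2^-1 ^+ N))//.
      by rewrite lerXn2r// ?nnegrE ?invr_ge0// lef_pV2// ?posrE// ler_nat.
    by rewrite ler_peMl ?exprn_ge0 ?invr_ge0// ler1n.
  (* A least index 0 would mean [1 <= |b y|]. Otherwise minimality of [k.+1] gives [|b y| < 4^-k],
     four times the square of [2^-(k+1)], which in turn is a lower bound for [|xi (p y)|]. *)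
  move=> /[dup] exk /ex_minnP[[|k] Hk kmin] b1.
    by move: Hk; rewrite expr0 leNgt b1.
  have /Fxi h : F k.+1 (p y) by exists y.
  have : cmod (b y) <= 4 * 4^-1 ^+ k.+1.
    rewrite exprS mulVKf ?pnatr_eq0// leNgt; apply/negP => /ltW /kmin.
    by rewrite ltnn.
  move=> /le_trans; apply; rewrite quarter ler_pM2l// lerXn2r//.
    by rewrite nnegrE exprn_ge0// invr_ge0.
  by rewrite nnegrE cmod_ge0.
have b0 y : xi (p y) = 0 -> b y = 0.
  move=> xiy; apply/eqP; rewrite -cmod_eq0; apply/eqP.
  have [b1|] := ltP (cmod (b y)) 1.
    apply/eqP; rewrite eq_le cmod_ge0 andbT.
    by rewrite (le_trans (b_le _ b1))// xiy cmod0 expr0n mulr0.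
  move=> b1; have /(Fxi 0%N) : F 0%N (p y) by exists y; rewrite //= expr0.
  by rewrite xiy cmod0 expr0 ler10.
have cc : continuous (fun y => b y / xi (p y)).
  move=> y0; have [xiy0|xiy0] := eqVneq (xi (p y0)) 0; last first.
    apply: cvgM; first exact: cts_fun.
    by apply: cvgV => //; exact: (pullback_cts (p := p)).
  apply/cvgrPdist_le => e e0; rewrite xiy0 invr0 mulr0.
  rewrite -(RRe_real (gtr0_real e0)); move: e0; rewrite ltcE => /andP[_ /=].
  move: (complex.Re e) => r r0.
  (* Near [y0] the quotient has modulus at most [4 |xi (p y)|], hence the choice [r / 4]. *)
  have r4 : 0 < ((r / 4)%:C%C : C) by rewrite ltcR divr_gt0.
  have cxp : {for y0, continuous (fun y => xi (p y))} by exact: pullback_cts.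
  have /cvgrPdist_le/(_ _ r4) := cxp.
  have /cvgrPdist_lt/(_ _ (@ltr01 C)) := @cts_fun _ _ b y0.
  apply: filterS2 => y; rewrite xiy0 (b0 _ xiy0) !sub0r !normrN !cmodE lecR ltcR.
  move=> /b_le by1 xiy; rewrite lecR; have [xi0'|xi0'] := eqVneq (xi (p y)) 0.
    by rewrite xi0' invr0 mulr0 cmod0 ltW.
  have xip : 0 < cmod (xi (p y)) by rewrite lt_def cmod_eq0 xi0' cmod_ge0.
  rewrite -(ler_pM2r xip) -cmodM divfK// (le_trans by1)//.
  by rewrite expr2 mulrA ler_pM2r//; lra.
exists xi, (cfun_of cc); split => // y /=.
have [xi0'|xi0'] := eqVneq (xi (p y)) 0; last by rewrite divfK.
by rewrite xi0' mulr0 b0.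
Qed.

End Factorization.

(** * Dual bases of C(Y) over C(X), finiteness of fibres and the trace *)

Section Fibres.
Context (R : realType) (X Y : topologicalType) (p : continuousType Y X).
Local Notation C := (complex R : numClosedFieldType).

Definition pull (xi : cfun R X) : cfun R Y := cfun_of (@pullback_cts R X Y p xi).

Definition dual_basis n (u : 'I_n -> cfun R Y)
    (al : 'I_n -> cfun R Y -> cfun R X) : Prop :=
  [/\ forall j f g, al j (f + g) = al j f + al j g,
      forall j f xi, al j (f * pull xi) = al j f * xi &
      forall f, f = \sum_j u j * pull (al j f)].

(** Duplicate-free lists record the finiteness of the fibres and let fibre sums be written as
    iterated sums. *)
Definition fibre_enum (fib : X -> seq Y) : Prop :=
  forall x, uniq (fib x) /\ forall y, (y \in fib x) = (p y == x).

Definition fibre_sum_continuous (fib : X -> seq Y) : Prop :=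
  forall f : cfun R Y, continuous (fun x => \sum_(y <- fib x) f y : C).

Hypotheses (cX : compact [set: X]) (hX : hausdorff_space X).
Hypotheses (cY : compact [set: Y]) (hY : hausdorff_space Y).

(** The points of [s] other than [a] form a finite, hence closed, set, which a Urysohn function
    separates from [a]. *)
Lemma separating_cfuns (s : seq Y) : exists d : Y -> cfun R Y,
  forall a b, b \in s -> d a b = (a == b)%:R.
Proof.
suff /choice[d Hd] (a : Y) : exists h : cfun R Y,
    forall b, b \in s -> h b = (a == b)%:R by exists d.
have aY := hausdorff_accessible hY.
have [|||h [_ h0 h1]] := @urysohn_cfun R Y [set b | b \in s /\ b != a] [set a] cY hY.
- apply: (accessible_finite_set_closed.1 aY).
  by apply: (@sub_finite_set _ _ [set` s]) => // b [].
- exact: accessible_closed_set1.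
- by rewrite -subset0 => b [[_ /eqP]].
exists h => b bs; have [<-|ab] := eqVneq a b; first exact: h1.
by apply: h0; split; rewrite // eq_sym.
Qed.

Section DualBasis.
Context (n : nat) (u : 'I_n -> cfun R Y) (al : 'I_n -> cfun R Y -> cfun R X).
Hypothesis ual : dual_basis u al.

Let alD j f g : al j (f + g) = al j f + al j g.
Proof. by case: ual. Qed.

Let alM j f xi : al j (f * pull xi) = al j f * xi.
Proof. by case: ual. Qed.

Let uK (f : cfun R Y) y : f y = \sum_j u j y * al j f (p y).
Proof. by case: ual => _ _ H; rewrite [in LHS](H f) sum_cfunE. Qed.

Let al0 j : al j 0 = 0.
Proof. by apply: (addrI (al j 0)); rewrite -alD !addr0. Qed.

Let al_sum j (I : Type) (r : seq I) (F : I -> cfun R Y) :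
  al j (\sum_(i <- r) F i) = \sum_(i <- r) al j (F i).
Proof. exact: (big_morph (al j) (alD j) (al0 j)). Qed.

Let alZ j (c : C) f : al j (f * cfun_cst Y c) = al j f * cfun_cst X c.
Proof. by rewrite -alM; congr (al j (f * _)); apply: cfunP. Qed.

(** Expanding the separating functions of [s] in the dual basis and evaluating on [s] writes the
    identity matrix of size [size s] as a product through dimension [n]. *)
Lemma dual_basis_fibre_size x (s : seq Y) :
  uniq s -> (forall y, y \in s -> p y = x) -> (size s <= n)%N.
Proof.
move=> us sx; have [d dE] := separating_cfuns s.
pose t i := tnth (in_tuple s) i.
pose U := \matrix_(i < size s, j < n) (u j (t i) : C).
pose A := \matrix_(j < n, i < size s) (al j (d (t i)) x : C).
apply: (@mulmx1_min _ _ _ U A); apply/matrixP => i k; rewrite !mxE.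
have ti i' : t i' \in s by exact: mem_tnth.
transitivity (d (t k) (t i)).
  by rewrite uK sx//; apply: eq_bigr => j _; rewrite !mxE.
have tinj : injective t by apply/tuple_uniqP.
by rewrite dE// (inj_eq tinj) eq_sym.
Qed.

(** Lists of distinct points of a fibre have length at most [n]; one of maximal length exhausts the
    fibre. *)
Lemma dual_basis_fibre_enum : exists fib, fibre_enum fib.
Proof.
suff /choice[fib Hfib] (x : X) : exists s : seq Y,
    uniq s /\ forall y, (y \in s) = (p y == x) by exists fib.
pose P k := `[< exists s : seq Y,
  [/\ uniq s, forall y, y \in s -> p y = x & size s = k] >].
have exP : exists k, P k by exists 0%N; apply/asboolP; exists [::].
have ubP k : P k -> (k <= n)%N.
  by move=> /asboolP[s [us sx <-]]; exact: dual_basis_fibre_size us sx.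
have [k /asboolP[s [us sx sk]] kmax] := ex_maxnP exP ubP.
exists s; split => // y; apply/idP/eqP => [/sx//|yx].
apply/negPn/negP => ys.
have /kmax : P k.+1.
  apply/asboolP; exists (y :: s); split; rewrite /= ?ys ?sk// => z.
  by rewrite inE => /predU1P[->//|/sx].
by rewrite ltnn.
Qed.

(** The difference factors as [c * pull xi] with [xi x = 0], and [al j] takes this to [al j c * xi],
    which vanishes at [x]. *)
Lemma dual_basis_local (f g : cfun R Y) x j :
  (forall y, p y = x -> f y = g y) -> al j f x = al j g x.
Proof.
move=> fg; have [y /fg|xi [c [xi0 h]]] := @factor_vanishing R X Y p cX hX cY (f - g) x.
  by move=> fgy; apply/eqP; rewrite subr_eq0; apply/eqP.
have -> : f = g + c * pull xi.
  by apply: cfunP => y; rewrite -[f y](subrK (g y)) addrC; congr (_ + _); exact: h.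
rewrite alD alM; transitivity (al j g x + al j c x * xi x) => //.
by rewrite xi0 mulr0 addr0.
Qed.

(* The trace over C(X) of multiplication by [f]. *)
Lemma dual_basis_trace fib (f : cfun R Y) x : fibre_enum fib ->
  \sum_(y <- fib x) f y = (\sum_j al j (f * u j)) x.
Proof.
move=> /(_ x)[us fx]; have [d dE] := separating_cfuns (fib x).
rewrite sum_cfunE.
(* Each [f a] equals [f a * d a a], with [d a] expanded in the dual basis at the point [a]. *)
transitivity (\sum_j \sum_(a <- fib x) al j (d a) x * (f a * u j a)).
  rewrite exchange_big/= big_seq [RHS]big_seq; apply: eq_bigr => a.
  rewrite fx => /eqP pa; have aE : d a a = 1 by rewrite dE ?eqxx// fx pa.
  rewrite -[LHS]mulr1 -aE (uK (d a)) pa mulr_sumr; apply: eq_bigr => j _.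
  by rewrite mulrA mulrC.
apply: eq_bigr => j _.
(* The combination of the [d a] with coefficients [f a * u j a] agrees with [f * u j] on the fibre,
   so locality identifies their images at [x]. *)
transitivity (al j (\sum_(a <- fib x) d a * cfun_cst Y (f a * u j a)) x).
  by rewrite al_sum sum_cfunE; apply: eq_bigr => a _; rewrite alZ.
apply: dual_basis_local => y yx; rewrite sum_cfunE.
have yf : y \in fib x by rewrite fx yx.
rewrite (bigD1_seq y)//= big1_seq => [|a /andP[ay af]].
  rewrite addr0; transitivity (d y y * (f y * u j y)) => //.
  by rewrite dE// eqxx mul1r.
transitivity (d a y * (f a * u j a)) => //.
by rewrite dE// (negPf ay) mul0r.
Qed.

Lemma dual_basis_fibre_sum fib :
  fibre_enum fib -> fibre_sum_continuous fib.
Proof.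
move=> ef f.
rewrite (_ : (fun _ => _) = \sum_j al j (f * u j) :> (X -> C)).
  exact: cts_fun.
by apply/funext => x; rewrite dual_basis_trace.
Qed.

End DualBasis.

End Fibres.

(** * Continuous fibre sums force p to be a covering *)

Section Covering.
Context (R : realType) (X Y : topologicalType) (p : continuousType Y X).
Hypothesis p_surj : forall x : X, exists y : Y, p y = x.
Hypotheses (cY : compact [set: Y]) (hY : hausdorff_space Y).
Local Notation C := (complex R : numClosedFieldType).
Context (fib : X -> seq Y).
Hypotheses (fibP : fibre_enum p fib) (fib_sum : fibre_sum_continuous R fib).

(** This turns continuity of a count into local constancy, and makes the discs of radius 1/2 about
    distinct naturals disjoint. *)
Lemma natr_close (m n : nat) : `|(m%:R - n%:R : C)| < 1 -> m = n.
Proof.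
wlog mn : m n / (m <= n)%N => [W|].
  by have [/W//|/ltnW nm] := leqP m n; rewrite distrC => /(W _ _ nm)->.
rewrite distrC -natrB// normr_nat ltrn1 => nm.
by apply/eqP; rewrite eqn_leq mn -subn_eq0 -leqn0 -ltnS.
Qed.

(** A bump at [y] that vanishes off [O] has nonzero fibre sum at [p y], hence at all nearby points;
    a nonzero sum requires a point of the fibre in [O]. *)
Lemma fibre_sum_open (O : set Y) : open O -> open (p @` O).
Proof.
move=> oO; rewrite openE => _ [y Oy <-].
have [g [g01 g0 g1]] := bump_cfun R cY hY oO Oy.
have [uf fP] := fibP (p y).
have yf : y \in fib (p y) by rewrite fP.
have tpos : \sum_(z <- fib (p y)) g z != 0.
  rewrite (bigD1_seq y)//= g1 gt_eqF// ltr_pwDl// sumr_ge0// => z _.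
  by case/andP: (g01 z).
have : \forall x \near p y, \sum_(z <- fib x) g z != 0.
  by apply: cvgr_neq0 tpos; exact: fib_sum.
apply: filterS => x /eqP tx; apply: contrapT => nx; apply: tx.
rewrite big_seq big1// => z; rewrite (fibP x).2 => /eqP pz.
by apply: g0 => Oz; apply: nx; exists z.
Qed.

Lemma fibre_size_locally_constant x :
  \forall z \near x, size (fib z) = size (fib x).
Proof.
have /cvgrPdist_lt/(_ _ (@ltr01 C)) := @fib_sum 1 x.
apply: filterS => z.
have sizeE t : \sum_(y <- fib t) (1 : cfun R Y) y = (size (fib t))%:R.
  by rewrite (eq_bigr (fun=> 1))// big_const_seq count_predT iter_addr_0.
by rewrite !sizeE => /natr_close.
Qed.

Lemma separating_nbhds (s : seq Y) : uniq s -> exists V : 'I_(size s) -> set Y,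
  [/\ forall k, open (V k), forall k, V k (tnth (in_tuple s) k) &
      forall k l y, V k y -> V l y -> k = l].
Proof.
move=> us; have [d dE] := separating_cfuns R cY hY s.
(* A single function taking the value [k] at the [k]-th point of [s]; the neighbourhoods are the
   preimages of discs of radius 1/2. *)
pose h : cfun R Y := \sum_(a <- s) ((index a s)%:R : C) *: d a.
have hE k : h (tnth (in_tuple s) k) = k%:R.
  have ks : tnth (in_tuple s) k \in s by exact: (mem_tnth k (in_tuple s)).
  rewrite sum_cfunE (bigD1_seq (tnth (in_tuple s) k))//= big1_seq.
    rewrite addr0; transitivity ((index (tnth (in_tuple s) k) s)%:R *
        d (tnth (in_tuple s) k) (tnth (in_tuple s) k) : C) => //.
    by rewrite dE// eqxx mulr1 (tnth_nth (tnth (in_tuple s) k)) index_uniq.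
  move=> a /andP[ak as_].
  transitivity ((index a s)%:R * d a (tnth (in_tuple s) k) : C) => //.
  by rewrite dE// (negPf ak) mulr0.
exists (fun k => [set y | cmod (h y - k%:R) < 2^-1]); split.
- move=> k; apply: (@open_comp _ _ (fun y => cmod (h y - k%:R))
    [set r : R | r < 2^-1]); last exact: open_lt.
  move=> y _; apply: continuous_cmod => {}y.
  by apply: cvgB; [exact: cts_fun|exact: cvg_cst].
- by move=> k /=; rewrite hE subrr cmod0 invr_gt0.
- move=> k l y /= hk hl; apply/val_inj/natr_close.
  rewrite cmodE -(rmorph1 (real_complex R)) ltcR.
  rewrite -(subrKA (h y)) (le_lt_trans (cmodD _ _))// cmodB.
  by rewrite [ltRHS]splitr mul1r ltrD.
Qed.

Lemma fibre_sum_covering : finite_fold_covering p.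
Proof.
move=> x; have [us _] := fibP x.
have [V0 [oV0 V0s V0dis]] := separating_nbhds us.
(* Over [W] the fibre meets each [V0 k] in exactly one point. The evenly covered set will be the
   interior of [W]. *)
pose W := [set z | size (fib z) = size (fib x) /\ forall k, (p @` V0 k) z].
have Wx : nbhs x W.
  apply: filterI; first exact: fibre_size_locally_constant.
  apply: filter_forall => k; apply: open_nbhs_nbhs; split.
    exact: fibre_sum_open.
  exists (tnth (in_tuple (fib x)) k) => //; apply/eqP.
  by rewrite -(fibP x).2; exact: (mem_tnth k (in_tuple (fib x))).
(* The [size (fib x)] pairwise disjoint sets [V0 k] all meet the fibre of [z],
   which has as many points. *)
have WV0 z : W z -> exists t : 'I_(size (fib x)) -> Y,
    (forall k, V0 k (t k)) /\ forall y, p y = z <-> exists k, y = t k.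
  move=> [sz Wz]; have /choice[t Ht] k : exists y, V0 k y /\ p y = z.
    by have [y V0y yz] := Wz k; exists y.
  exists t; split => [k|y]; first by case: (Ht k).
  have tz k : p (t k) = z by case: (Ht k).
  have tinj : injective t.
    move=> k l tkl; apply: (V0dis _ _ (t k)); first by case: (Ht k).
    by rewrite tkl; case: (Ht l).
  have [] := @uniq_min_size _ [seq t k | k <- enum 'I_(size (fib x))] (fib z).
  - by rewrite map_inj_uniq// enum_uniq.
  - by move=> _ /mapP[k _ ->]; rewrite (fibP z).2 tz.
  - by rewrite size_map -cardT card_ord sz.
  move=> _ tfib; split => [yz|[k ->]//].
  have : y \in fib z by rewrite (fibP z).2 yz.
  by rewrite -tfib => /mapP[k _ ->]; exists k.
have oU : open W° by exact: open_interior.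
have oV k : open (V0 k `&` p @^-1` W°).
  by apply: openI => //; apply: open_comp => // y _; exact: cts_fun.
exists W°; split => //; exists (size (fib x)), (fun k => V0 k `&` p @^-1` W°).
split => //.
- by move=> k l _ _ [y [[+ _] [+ _]]]; exact: V0dis.
- apply/seteqP; split => [y Wy|y [k _ []]//].
  have [t [V0t /(_ y)[/(_ erefl)[k yt] _]]] := WV0 _ (interior_subset Wy).
  by exists k => //; split => //; rewrite yt.
move=> k.
(* The section must be total on [X]; outside the interior of [W] its value is arbitrary and comes
   from surjectivity. *)
have /choice[q Hq] (z : X) : exists y, W° z -> V0 k y /\ p y = z.
  have [Wz|nW] := pselect (W° z); last by have [y _] := p_surj z; exists y.
  by have [_ /(_ k)[y V0y yz]] := interior_subset Wz; exists y.
have qK y : (V0 k `&` p @^-1` W°) y -> q (p y) = y.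
  move=> [V0y Wy]; have [V0q pq] := Hq _ Wy.
  (* Both [y] and [q (p y)] are listed by [t] and lie in [V0 k]; by disjointness both are [t k]. *)
  have [t [V0t tP]] := WV0 _ (interior_subset Wy).
  have [l yt] := (tP y).1 erefl; have [m qt] := (tP _).1 pq.
  move: V0q; rewrite qt => V0q; rewrite (V0dis _ _ _ (V0t m) V0q).
  by move: V0y; rewrite yt => V0y; rewrite (V0dis _ _ _ (V0t l) V0y).
exists q; split.
- split => [y [] //|z Wz]; have [? pq] := Hq _ Wz.
  by split => //=; rewrite pq.
- by split => [y|z]; rewrite inE; [exact: qK|move=> /Hq[]].
- by apply: continuous_subspaceT; exact: cts_fun.
(* Openness of [p] makes [q] continuous: the image of the part of [O] inside the sheet is a
   neighbourhood of [z] that [q] maps back into [O]. *)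
- rewrite continuous_open_subspace// => z; rewrite inE => Wz A.
  rewrite nbhsE => -[O [oO Oz] OA].
  have [V0q pq] := Hq _ Wz.
  have : nbhs z (p @` (O `&` (V0 k `&` p @^-1` W°))).
    apply: open_nbhs_nbhs; split.
      by apply: fibre_sum_open; exact: openI.
    by exists (q z) => //; split => //; split => //=; rewrite pq.
  by apply: filterS => _ [y [Oy Vy] <-]; apply: OA; rewrite qK.
Qed.

End Covering.

(** * Local sections of a covering and continuity of its fibre sums *)

Section CoveringFibres.
Context (R : realType) (X Y : topologicalType) (p : continuousType Y X).
Local Notation C := (complex R : numClosedFieldType).
Hypothesis p_cov : finite_fold_covering p.

(** The sections invert [p] on the sheets over an evenly covered set; disjointness of the sheets
    makes their values distinct. *)
Lemma covering_sections (x : X) :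
  exists (U : set X) (n : nat) (q : 'I_n -> X -> Y),
  [/\ open U, U x, forall k, {in U, continuous (q k)} &
    forall z, U z -> uniq [seq q k z | k <- enum 'I_n] /\
      forall y, (y \in [seq q k z | k <- enum 'I_n]) = (p y == z)].
Proof.
have [U [oU Ux [n [V [oV tV pU Vhomeo]]]]] := p_cov x.
have /choice[q Hq] := Vhomeo.
exists U, n, q; split => // [k|z Uz].
  by have [_ _ _] := Hq k; rewrite continuous_open_subspace.
have Vq k : V k (q k z) by have [[_ /(_ z Uz)]] := Hq k.
have pq k : p (q k z) = z by have [_ [_ /(_ z (mem_set Uz))]] := Hq k.
split.
  rewrite map_inj_uniq ?enum_uniq// => k l qkl; apply: (tV k l) => //.
  by exists (q k z); split => //; rewrite qkl.
move=> y; apply/mapP/eqP => [[k _ ->]//|yz].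
have : (p @^-1` U) y by rewrite /= yz.
rewrite pU => -[k _ Vy]; exists k; first by rewrite mem_enum.
by have [_ [/(_ y (mem_set Vy)) + _] _ _] := Hq k; rewrite yz.
Qed.

Lemma covering_fibre_enum : exists fib, fibre_enum p fib.
Proof.
suff /choice[fib Hfib] (x : X) : exists s : seq Y,
    uniq s /\ forall y, (y \in s) = (p y == x) by exists fib.
have [U [n [q [_ Ux _ /(_ x Ux)]]]] := covering_sections x.
by exists [seq q k x | k <- enum 'I_n].
Qed.

(** Near [x] the list [fib z] is a permutation of the values of the local sections, so the fibre sum
    is a finite sum of continuous functions [f (q k z)]. *)
Lemma covering_fibre_sum fib : fibre_enum p fib -> fibre_sum_continuous R fib.
Proof.
move=> fibP f x; have [U [n [q [oU Ux cq qP]]]] := covering_sections x.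
have sumE z : U z -> \sum_(y <- fib z) f y = \sum_(k < n) f (q k z).
  move=> Uz; have [uq fq] := qP z Uz; have [uf ff] := fibP z.
  rewrite (perm_big [seq q k z | k <- enum 'I_n]) ?big_map ?big_enum//=.
  by apply: uniq_perm => // y; rewrite ff fq.
rewrite /continuous_at sumE//.
apply: (@cvg_trans _ ((fun z => \sum_(k < n) f (q k z)) @ x)).
  apply: near_eq_cvg; apply: filterS (open_nbhs_nbhs (conj oU Ux)) => z Uz.
  by rewrite sumE.
apply: cvg_big => [|k _]; first exact: add_continuous.
apply: (continuous_comp (cq k x (mem_set Ux))).
exact: cts_fun.
Qed.

Lemma covering_locally_injective (y : Y) :
  exists V : set Y, [/\ open V, V y &
    forall a b, V a -> V b -> p a = p b -> a = b].
Proof.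
have [U [oU Ux [n [V [oV tV pU Vhomeo]]]]] := p_cov (p y).
have : (p @^-1` U) y by [].
rewrite pU => -[k _ Vy]; exists (V k); split => // a b Va Vb pab.
have [q [_ [qK _] _ _]] := Vhomeo k.
by rewrite -(qK a (mem_set Va)) pab qK//; exact: mem_set.
Qed.

End CoveringFibres.

(** * Fibre sum and fibre mean; the mean is a conditional expectation *)

Section FibreSum.
Context (R : realType) (X Y : topologicalType) (p : continuousType Y X).
Local Notation C := (complex R : numClosedFieldType).
Hypothesis p_surj : forall x : X, exists y : Y, p y = x.
Hypotheses (cX : compact [set: X]) (cY : compact [set: Y]).
Context (fib : X -> seq Y).
Hypotheses (fibP : fibre_enum p fib) (fib_sum : fibre_sum_continuous R fib).

Definition fibre_sum (f : cfun R Y) : cfun R X := cfun_of (@fib_sum f).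

Lemma fibre_sumD f g : fibre_sum (f + g) = fibre_sum f + fibre_sum g.
Proof. by apply: cfunP => x; exact: big_split. Qed.

Lemma fibre_sum_pull (f : cfun R Y) (xi : cfun R X) :
  fibre_sum (f * pull p xi) = fibre_sum f * xi.
Proof.
apply: cfunP => x; transitivity ((\sum_(y <- fib x) f y) * xi x) => //.
rewrite mulr_suml [LHS]big_seq [RHS]big_seq; apply: eq_bigr => y.
by rewrite (fibP x).2 => /eqP <-.
Qed.

Lemma fibre_sumZ c f : fibre_sum (c *: f) = c *: fibre_sum f.
Proof. by apply: cfunP => x; rewrite [RHS]mulr_sumr. Qed.

Lemma fibre_sum_star f :
  fibre_sum (cfun_star f) = cfun_star (fibre_sum f).
Proof. by apply: cfunP => x; exact/esym/(rmorph_sum Num.conj). Qed.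

(** Surjectivity of [p] is what permits division by the number of sheets. *)
Lemma fibre_size_gt0 x : (0 < size (fib x))%N.
Proof.
have [y yx] := p_surj x; have : y \in fib x by rewrite (fibP x).2 yx.
by case: (fib x).
Qed.

Lemma fibre_sum1 x : fibre_sum 1 x = (size (fib x))%:R.
Proof.
transitivity (\sum_(y <- fib x) (1 : C)) => //.
by rewrite big_const_seq count_predT iter_addr_0.
Qed.

Lemma fibre_sum_le (f : cfun R Y) (M : R) x : (forall y, `|f y| <= M%:C%C) ->
  `|fibre_sum f x| <= M%:C%C * fibre_sum 1 x.
Proof.
move=> fM; rewrite (le_trans (ler_norm_sum _ _ _))//.
by rewrite [leRHS]mulr_sumr ler_sum// => y _; rewrite mulr1.
Qed.

Lemma fibre_sum_sqr_ge0 (f : cfun R Y) : cfun_ge0 (fibre_sum (cfun_star f * f)).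
Proof.
move=> x; apply: sumr_ge0 => y _.
by have := mul_conjC_ge0 (f y); rewrite mulrC.
Qed.

(** The left side is one of the nonnegative terms of the sum. This gives definiteness of the inner
    product and half of the norm comparison. *)
Lemma sqr_le_fibre_sum (f : cfun R Y) y :
  `|f y| ^+ 2 <= fibre_sum (cfun_star f * f) (p y).
Proof.
have yf : y \in fib (p y) by rewrite (fibP _).2.
rewrite normCK [leRHS](bigD1_seq y) ?(fibP _).1//= mulrC lerDl.
apply: sumr_ge0 => z _.
by have := mul_conjC_ge0 (f z); rewrite mulrC.
Qed.

Let size_neq0 x : (size (fib x))%:R != 0 :> C.
Proof. by rewrite pnatr_eq0 -lt0n fibre_size_gt0. Qed.

Lemma fibre_size_inv_cts : continuous (fun x => (fibre_sum 1 x)^-1 : C).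
Proof.
move=> x; apply: cvgV; first by rewrite fibre_sum1; exact: size_neq0.
exact: cts_fun.
Qed.

Definition fibre_mean (f : cfun R Y) : cfun R X :=
  fibre_sum f * cfun_of fibre_size_inv_cts.

Lemma fibre_meanE f x :
  fibre_mean f x = (\sum_(y <- fib x) f y) / (size (fib x))%:R.
Proof.
transitivity ((\sum_(y <- fib x) f y) / fibre_sum 1 x) => //.
by rewrite fibre_sum1.
Qed.

Lemma fibre_mean1 : fibre_mean 1 = 1.
Proof.
apply: cfunP => x; transitivity (fibre_sum 1 x / fibre_sum 1 x) => //.
by rewrite fibre_sum1 divff//; exact: size_neq0.
Qed.

Lemma fibre_mean_pull (f : cfun R Y) (xi : cfun R X) :
  fibre_mean (f * pull p xi) = fibre_mean f * xi.
Proof. by rewrite /fibre_mean fibre_sum_pull mulrAC. Qed.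

Lemma fibre_mean_le (f : cfun R Y) (M : R) x : (forall y, `|f y| <= M%:C%C) ->
  `|fibre_mean f x| <= M%:C%C.
Proof.
move=> fM; have -> : `|fibre_mean f x| = `|fibre_sum f x| / fibre_sum 1 x.
  rewrite [X in `|X|](_ : _ = fibre_sum f x / fibre_sum 1 x)//.
  by rewrite normrM normfV fibre_sum1 normr_nat.
rewrite ler_pdivrMr; first exact: fibre_sum_le.
by rewrite fibre_sum1 ltr0n fibre_size_gt0.
Qed.

Section ConditionalExpectation.
Context (i : cfun R X -> cfun R Y).
Hypothesis p_dual : forall (xi : cfun R X) (y : Y), i xi y = xi (p y).

Let iE xi : i xi = pull p xi.
Proof. by apply: cfunP => y; rewrite p_dual. Qed.

Lemma fibre_mean_cond_exp : is_cond_exp i fibre_mean.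
Proof.
have proj a : fibre_mean (i a) = a.
  by rewrite iE -[pull p a]mul1r fibre_mean_pull fibre_mean1 mul1r.
have modr a b : fibre_mean (b * i a) = fibre_mean b * a.
  by rewrite iE fibre_mean_pull.
split=> //.
- move=> c f g; rewrite /fibre_mean fibre_sumD fibre_sumZ mulrDl.
  by congr (_ + _); apply: cfunP => x; exact: (esym (mulrA _ _ _)).
- by move=> a; exists (i a).
- move=> [x0 _]; rewrite /op_norm; set S := [set _ | _ in _].
  have ubS : ubound S 1.
    move=> _ [b /= b1 <-]; apply: cfun_norm_le => // x.
    by apply: fibre_mean_le => y; rewrite (le_trans (cfun_norm_ub _ _ cY))// lecR.
  (* The constant function 1 attains the norm; the point [x0] shows that its image has norm at least
     1. *)
  have S1 : S 1.
    exists 1.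
      by apply: cfun_norm_le => // y; rewrite /= normr1.
    apply/eqP; rewrite fibre_mean1 eq_le; apply/andP; split.
      by apply: cfun_norm_le => // x; rewrite normr1.
    by rewrite -lecR (le_trans _ (cfun_norm_ub _ x0 cX))// normr1.
  apply/eqP; rewrite eq_le; apply/andP; split; first by apply: ge_sup => //; exists 1.
  by apply: ub_le_sup => //; exists 1.
- by move=> a b; rewrite mulrC modr mulrC.
Qed.

Lemma fibre_mean_positive : positive_map fibre_mean.
Proof.
move=> b x; rewrite fibre_meanE divr_ge0 ?ler0n//.
exact: fibre_sum_sqr_ge0.
Qed.

End ConditionalExpectation.

End FibreSum.

(** * A quasi-basis for the fibre mean, and the Hilbert module structure *)

Section QuasiBasis.
Context (R : realType) (X Y : topologicalType) (p : continuousType Y X).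
Local Notation C := (complex R : numClosedFieldType).
Hypothesis p_surj : forall x : X, exists y : Y, p y = x.
Hypotheses (cX : compact [set: X]).
Hypotheses (cY : compact [set: Y]) (hY : hausdorff_space Y).
Hypothesis p_linj : forall y : Y, exists V : set Y, [/\ open V, V y &
    forall a b, V a -> V b -> p a = p b -> a = b].
Context (fib : X -> seq Y).
Hypotheses (fibP : fibre_enum p fib) (fib_sum : fibre_sum_continuous R fib).

Lemma open_cover_finite (f : Y -> set Y) :
  (forall y, open (f y)) -> (forall y, f y y) ->
  exists s : seq Y, forall z, exists2 y, y \in s & f y z.
Proof.
move=> of_ fy; have [[y0 _]|Y0] := pselect ([set: Y] !=set0); last first.
  by exists [::] => z; case: Y0; exists z.
(* Cover compactness is applied to a pointed space, hence the case split on emptiness of [Y]. *)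
pose Y' : ptopologicalType := HB.pack (Y : Type) (isPointed.Build Y y0) Y.
have : @compact Y' [set: Y'] := cY.
rewrite compact_cover => /(_ Y [set: Y] f).
case=> [y _|y _|D _ Df]; [exact: of_|by exists y|].
by exists (finmap.enum_fset D) => z; have [y yD fyz] := Df z I; exists y.
Qed.

(** Take bumps supported in open sets on which [p] is injective; by compactness, finitely many of
    their nonvanishing sets cover [Y]. *)
Lemma locally_injective_bumps : exists (n : nat) (g : 'I_n -> cfun R Y),
  [/\ forall j y, 0 <= g j y,
      forall j a b, p a = p b -> g j a != 0 -> g j b != 0 -> a = b &
      forall y, exists j, g j y != 0].
Proof.
have /choice[g Hg] (y : Y) : exists g : cfun R Y, [/\ forall z, 0 <= g z,
    forall a b, p a = p b -> g a != 0 -> g b != 0 -> a = b & g y = 1].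
  have [V [oV Vy Vinj]] := p_linj y.
  have [g [g01 g0 g1]] := bump_cfun R cY hY oV Vy.
  exists g; split => // [z|a b pab ga gb]; first by case/andP: (g01 z).
  by apply: Vinj => //; apply: contrapT => /g0 /eqP; apply/negP.
have [y|y|s Hs] := @open_cover_finite (fun y => [set z | 0 < cmod (g y z)]).
- apply: (@open_comp _ _ (fun z => cmod (g y z)) [set r : R | 0 < r]).
    by move=> z _; apply: continuous_cmod; exact: cts_fun.
  exact: open_gt.
- by case: (Hg y) => _ _ /= ->; rewrite lt_def cmod_eq0 oner_eq0 cmod_ge0.
exists (size s), (fun j => g (tnth (in_tuple s) j)); split.
- by move=> j; case: (Hg (tnth (in_tuple s) j)).
- by move=> j; case: (Hg (tnth (in_tuple s) j)).
move=> z; have [y ys] := Hs z; rewrite /= lt_def cmod_eq0 => /andP[gz _].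
by have /tnthP[j yj] : y \in in_tuple s by []; exists j; rewrite -yj.
Qed.

(* With functions [g j] supported where [p] is injective, the sum over the
   fibre defining [E (u_j^* b)] has at most one nonzero term; the rescaling makes
   [\sum_j |u_j|^2] equal to the number of points of the fibre. *)
Lemma fibre_mean_index_finite (i : cfun R X -> cfun R Y) :
  (forall (xi : cfun R X) (y : Y), i xi y = xi (p y)) ->
  index_finite i (fibre_mean p_surj fibP fib_sum).
Proof.
move=> p_dual; have [n [g [g_ge0 g_inj g_cov]]] := locally_injective_bumps.
pose G : cfun R Y := \sum_j g j * g j.
have GE y : G y = \sum_j g j y * g j y by rewrite /G sum_cfunE.
have Gpos y : 0 < G y.
  have [j gj] := g_cov y; rewrite GE (bigD1 j)//=.
  rewrite ltr_pwDl ?sumr_ge0//; last by move=> k _; rewrite mulr_ge0.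
  by rewrite mulr_gt0// lt_def gj g_ge0.
pose N : cfun R X := fibre_sum fib_sum 1.
have NE x : N x = (size (fib x))%:R by exact: fibre_sum1.
(* The factor [c] is the square root of this quotient: the squares of the [g j * c] then sum to
   [N (p y)], cancelling the denominator of the mean. *)
have cq : continuous (fun y => N (p y) / G y).
  move=> y; apply: cvgM; first exact: pullback_cts.
  by apply: cvgV; [rewrite gt_eqF|exact: cts_fun].
have cc : continuous (fun y => (Num.sqrt (complex.Re (N (p y) / G y)))%:C%C : C).
  apply: continuous_complex => y; apply: continuous_comp.
    exact: (continuous_Re cq).
  exact: sqrt_continuous.
pose c := cfun_of cc.
have c2 y : c y * c y = N (p y) / G y.
  have q0 : 0 <= N (p y) / G y by rewrite NE divr_ge0// ltW.
  transitivity ((Num.sqrt (complex.Re (N (p y) / G y)) ^+ 2)%:C%C : C).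
    by rewrite rmorphXn expr2.
  rewrite sqr_sqrtr ?RRe_real ?ger0_real//.
  by move: q0; rewrite lecE => /andP[].
have c_conj y : (c y)^* = c y.
  by apply: conj_Creal; rewrite ger0_real// ler0c sqrtr_ge0.
exists n, (fun j => g j * c) => b; apply: cfunP => y.
have N0 : N (p y) != 0 by rewrite NE pnatr_eq0 -lt0n (fibre_size_gt0 p_surj fibP).
have yf : y \in fib (p y) by rewrite (fibP _).2.
rewrite sum_cfunE.
transitivity (\sum_j (g j y * c y) * ((g j y * c y) * b y / N (p y))); last first.
  apply: eq_bigr => j _.
  transitivity ((g j y * c y) *
      i (fibre_mean p_surj fibP fib_sum (cfun_star (g j * c) * b)) y) => //.
  rewrite p_dual fibre_meanE NE.
  have [gj|gj] := eqVneq (g j y) 0; first by rewrite gj !mul0r.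
  congr (_ * (_ / _)); rewrite (bigD1_seq y) ?(fibP _).1//= big1_seq.
    rewrite addr0; transitivity ((g j y * c y)^* * b y) => //.
    by rewrite rmorphM/= c_conj conj_Creal// ger0_real.
  move=> z /andP[zy]; rewrite (fibP _).2 => /eqP pz.
  have gz : g j z = 0.
    apply/eqP/negPn/negP => gz; move/eqP: zy; apply.
    exact: g_inj pz gz gj.
  transitivity ((g j z * c z)^* * b z) => //.
  by rewrite gz mul0r rmorph0 mul0r.
transitivity (\sum_j (g j y * g j y) * (c y * c y * (b y / N (p y)))); last first.
  by apply: eq_bigr => j _; rewrite -!mulrA (mulrCA (c y) (g j y)).
rewrite -mulr_suml -GE c2 [RHS]mulrA [G y * _]mulrC divfK ?gt_eqF//.
by rewrite mulrC divfK.
Qed.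

Definition fibre_ip (f g : pullback_module R p) : cfun R X :=
  fibre_sum fib_sum (cfun_star f * (g : cfun R Y)).

(** Together with [hilbert_norm_le] this makes the Hilbert norm equivalent to the sup norm, so
    completeness is inherited from C(Y). *)
Lemma le_hilbert_norm (f : pullback_module R p) y :
  `|f y| <= (hilbert_norm fibre_ip f)%:C%C.
Proof.
rewrite cmodE lecR -(ger0_norm (cmod_ge0 _)) -sqrtr_sqr ler_sqrt.
  rewrite -lecR rmorphXn /= -cmodE.
  rewrite (le_trans (sqr_le_fibre_sum fibP fib_sum f y))//.
  rewrite (le_trans _ (cfun_norm_ub _ (p y) cX))//.
  by rewrite real_ler_norm// ger0_real//; exact: fibre_sum_sqr_ge0.
have [x0 _] := p_surj (p y).
by rewrite -ler0c (le_trans _ (cfun_norm_ub _ (p y) cX)).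
Qed.

Lemma hilbert_norm_le (e : R) (f : pullback_module R p) : 0 <= e ->
  (forall y, `|f y| <= e%:C%C) ->
  hilbert_norm fibre_ip f <= e * Num.sqrt (cfun_norm (fibre_sum fib_sum 1)).
Proof.
move=> e0 fe; have K0 : 0 <= cfun_norm (fibre_sum fib_sum 1).
  have [[x _]|X0] := pselect ([set: X] !=set0).
    by rewrite -ler0c (le_trans _ (cfun_norm_ub _ x cX)).
  rewrite /cfun_norm; have -> : range
      (fun x => complex.Re `|fibre_sum fib_sum 1 x|) = set0.
    by rewrite -subset0 => t [x _ _] /=; apply: X0; exists x.
  by rewrite sup0.
rewrite -{1}(ger0_norm e0) -sqrtr_sqr -sqrtrM ?sqr_ge0// ler_wsqrtr//.
apply: cfun_norm_le; first by rewrite mulr_ge0// sqr_ge0.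
move=> x; rewrite (@le_trans _ _ ((e ^+ 2)%:C%C * fibre_sum fib_sum 1 x))//.
  apply: fibre_sum_le => y.
  have -> : `|(cfun_star f * (f : cfun R Y)) y| = `|f y| ^+ 2.
    by rewrite expr2 -{1}(norm_conjC (f y)) -normrM.
  by rewrite rmorphXn/= lerXn2r// ?nnegrE// ler0c.
rewrite [leRHS]rmorphM ler_wpM2l ?ler0c ?sqr_ge0//.
rewrite (le_trans _ (cfun_norm_ub _ x cX))// real_ler_norm//.
by rewrite ger0_real// (fibre_sum1 fib_sum).
Qed.

Lemma fibre_ip_hilbert : is_hilbert_module fibre_ip.
Proof.
split.
- move=> c f g h; rewrite /fibre_ip -fibre_sumZ -fibre_sumD.
  congr fibre_sum; apply: cfunP => y.
  transitivity ((f y * c + g y)^* * h y) => //.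
  by rewrite rmorphD rmorphM/= mulrDl [_^* * c^*]mulrC -mulrA.
- move=> f g xi; rewrite /fibre_ip -(fibre_sum_pull fibP).
  by congr fibre_sum; exact: mulrA.
- move=> f g; rewrite /fibre_ip -fibre_sum_star; congr fibre_sum.
  apply: cfunP => y; transitivity (((f y)^* * g y)^*) => //.
  by rewrite rmorphM/= conjCK mulrC.
- by move=> f; exact: fibre_sum_sqr_ge0.
- move=> f f0; apply: cfunP => y; apply/eqP.
  rewrite -normr_eq0 -sqrf_eq0 eq_le exprn_ge0// andbT.
  by have := sqr_le_fibre_sum fibP fib_sum f y; rewrite -/(fibre_ip f f) f0.
move=> u uC; have [|l Hl] := @cfun_complete R Y u.
  move=> e /uC[N HN]; exists N => m n Nm Nn y.
  have /ltW := HN _ _ Nm Nn; rewrite -lecR; apply: le_trans.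
  exact: (le_hilbert_norm (u m - u n) y).
exists l => e e0; set K := Num.sqrt (cfun_norm (fibre_sum fib_sum 1)).
have K0 : 0 <= K by exact: sqrtr_ge0.
(* Using [K + 1] instead of [K] keeps the denominator positive and the final inequality strict. *)
have d0 : 0 < e / (K + 1) by rewrite divr_gt0// ltr_wpDl.
have [N HN] := Hl _ d0; exists N => n Nn.
have : hilbert_norm fibre_ip (u n - l) <= e / (K + 1) * K.
  by apply: hilbert_norm_le; [exact: ltW|exact: HN].
move=> /le_lt_trans; apply; rewrite mulrAC ltr_pdivrMr ?ltr_wpDl//.
by rewrite ltr_pM2l// ltrDl.
Qed.

End QuasiBasis.

(** * The kernel of a linear map as a module *)

Section KernelModule.
Context (A : pzRingType) (V W : lmodType A) (f : {linear V -> W}).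

Definition kernel_pred : {pred V} := [pred v | f v == 0].

Fact kernel_submod_closed : submod_closed kernel_pred.
Proof.
split=> [|a u v]; rewrite !inE ?linear0// linearP => /eqP-> /eqP->.
by rewrite scaler0 addr0.
Qed.

HB.instance Definition _ :=
  GRing.isSubmodClosed.Build A V kernel_pred kernel_submod_closed.

(** A type of its own, so that it can serve as the complementary summand in [fin_gen_projective]. *)
Record kernel_module := KernelModule
  { kernel_val :> V; _ : kernel_val \in kernel_pred }.

HB.instance Definition _ := [isSub for kernel_val].
HB.instance Definition _ := [Choice of kernel_module by <:].
HB.instance Definition _ := [SubChoice_isSubLmodule of kernel_module by <:].

End KernelModule.

(** * Dual bases from projective modules and from quasi-bases *)

Section FinGenProjective.
Context (R : realType) (X Y : topologicalType) (p : continuousType Y X).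
Local Notation M := (pullback_module R p).
Local Notation A := (cfun R X).

(** The coordinate map [L] is a section of the combination map [B], so the free module is the direct
    sum of a copy of [M] and the kernel of [B]. *)
Lemma dual_basis_fin_gen_projective n (u : 'I_n -> cfun R Y) al :
  dual_basis p u al -> fin_gen_projective M.
Proof.
move=> [alD alM uK].
pose B (w : 'rV[A]_n) : M := \sum_j w 0 j *: (u j : M).
have B_lin : linear B.
  move=> a v w; rewrite /B scaler_sumr -big_split; apply: eq_bigr => j _.
  by rewrite !mxE scalerDl scalerA.
pose Bl : {linear 'rV[A]_n -> M} :=
  HB.pack B (GRing.isLinear.Build _ _ _ _ B B_lin).
pose L (m : M) : 'rV[A]_n := \row_j al j m.
have L_lin : linear L.
  move=> a f g; apply/rowP => j; rewrite !mxE mulrC -alM -alD.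
  by congr al.
have LK m : B (L m) = m.
  rewrite [RHS]uK; apply: eq_bigr => j _; rewrite mxE.
  by apply: cfunP => y.
pose N := kernel_module Bl.
pose phi (x : (M * N)%type) : 'rV[A]_n := L x.1 + \val x.2.
have phi_lin : linear phi.
  move=> a x y; rewrite /phi L_lin (linearP (\val : N -> 'rV[A]_n)) scalerDr.
  by rewrite addrACA.
pose phil : {linear (M * N)%type -> 'rV[A]_n} :=
  HB.pack phi (GRing.isLinear.Build _ _ _ _ phi phi_lin).
exists n, N, phil.
have kerP w : w - L (B w) \in kernel_pred Bl.
  by rewrite inE linearB/= LK subrr.
exists (fun w => (B w, KernelModule (kerP w))) => [[m [v vB]]|w] /=; last first.
  by rewrite /phi/= addrC subrK.
have Bv : B v = 0 by exact: (eqP vB).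
have Bm : B (phi (m, KernelModule vB)) = m.
  by transitivity (B (L m) + B v); [exact: (linearD Bl)|rewrite LK Bv addr0].
congr (_, _); first exact: Bm.
by apply: val_inj => /=; rewrite Bm /phi/= addrC addKr.
Qed.

(** The [u j] are the [M]-components of the standard basis vectors, and [al j] is the [j]-th
    coordinate of the inclusion of [M] in the free module. *)
Lemma fin_gen_projective_dual_basis : fin_gen_projective M ->
  exists n (u : 'I_n -> cfun R Y) al, dual_basis p u al.
Proof.
move=> [n [N [phi [psi phiK psiK]]]].
have psi_lin : linear psi.
  move=> a v w; apply: (can_inj phiK).
  by rewrite psiK linearP !psiK.
pose Psi : {linear 'rV[A]_n -> (M * N)%type} :=
  HB.pack psi (GRing.isLinear.Build _ _ _ _ psi psi_lin).
exists n, (fun j => (Psi (delta_mx 0 j)).1), (fun j f => phi (f : M, 0 : N) 0 j).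
split.
- move=> j f g; have -> : ((f + g : M), 0 : N) = (f : M, 0 : N) + (g : M, 0 : N).
    by congr (_, _); rewrite addr0.
  by rewrite linearD mxE.
- move=> j f xi; have -> : ((f * pull p xi : M), 0 : N) = xi *: (f : M, 0 : N).
    by congr (_, _); rewrite /= scaler0.
  by rewrite linearZ mxE mulrC.
move=> f; transitivity (Psi (phi (f : M, 0 : N))).1; first by rewrite /= phiK.
rewrite [X in (Psi X).1]row_sum_delta linear_sum (big_morph (fun x : (M * N)%type => x.1)
  (id1 := 0) (op1 := +%R))//.
by apply: eq_bigr => j _; rewrite linearZ.
Qed.

Lemma index_finite_dual_basis (i : cfun R X -> cfun R Y) E :
  (forall (xi : cfun R X) (y : Y), i xi y = xi (p y)) ->
  is_cond_exp i E -> index_finite i E ->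
  exists n (u : 'I_n -> cfun R Y) al, dual_basis p u al.
Proof.
move=> p_dual [E_lin _ _ _ modr _] [n [u uK]].
have iE xi : i xi = pull p xi by apply: cfunP => y; rewrite p_dual.
exists n, u, (fun j f => E (cfun_star (u j) * f)); split.
- move=> j f g; rewrite mulrDr.
  by rewrite -[cfun_star _ * f]scale1r E_lin !scale1r.
- by move=> j f xi; rewrite mulrA -iE modr.
- by move=> f; rewrite [LHS]uK; apply: eq_bigr => j _; rewrite iE.
Qed.

End FinGenProjective.

(** * The three properties, as a cycle of implications *)

Theorem theorem1p3 (R : realType) (X Y : topologicalType)
    (compactX : compact [set: X]) (hausdorffX : hausdorff_space X)
    (compactY : compact [set: Y]) (hausdorffY : hausdorff_space Y)
    (i : {rmorphism cfun R X -> cfun R Y})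
    (i_scalable : forall (c : complex R) (xi : cfun R X),
       i (c *: xi) = c *: i xi)
    (i_star : forall xi : cfun R X, i (cfun_star xi) = cfun_star (i xi))
    (i_inj : injective i)
    (p : continuousType Y X)
    (p_surj : forall x : X, exists y : Y, p y = x)
    (p_dual : forall (xi : cfun R X) (y : Y), i xi y = xi (p y)) :
  [<-> finite_fold_covering p;
       (exists ip : pullback_module R p -> pullback_module R p -> cfun R X,
          is_hilbert_module ip) /\ fin_gen_projective (pullback_module R p);
       exists E : cfun R Y -> cfun R X,
         [/\ is_cond_exp i E, positive_map E, E 1 = 1 & index_finite i E]].
Proof.
have covering_exp : finite_fold_covering p -> exists E : cfun R Y -> cfun R X,
    [/\ is_cond_exp i E, positive_map E, E 1 = 1 & index_finite i E].
  move=> p_cov; have [fib fibP] := covering_fibre_enum p_cov.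
  have fib_sum := covering_fibre_sum (R := R) p_cov fibP.
  exists (fibre_mean p_surj fibP fib_sum); split.
  - exact: fibre_mean_cond_exp.
  - exact: fibre_mean_positive.
  - exact: fibre_mean1.
  - apply: fibre_mean_index_finite => //.
    exact: covering_locally_injective.
have dual_basis_covering : (exists n (u : 'I_n -> cfun R Y) al,
    dual_basis p u al) -> finite_fold_covering p.
  move=> [n [u [al ual]]].
  have [fib fibP] := dual_basis_fibre_enum compactY hausdorffY ual.
  apply: (@fibre_sum_covering R X Y p p_surj compactY hausdorffY fib fibP).
  exact: (dual_basis_fibre_sum compactX hausdorffX compactY hausdorffY ual).
tfae.
- move=> p_cov; split.
    have [fib fibP] := covering_fibre_enum p_cov.
    have fib_sum := covering_fibre_sum (R := R) p_cov fibP.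
    by exists (fibre_ip fib_sum); exact: fibre_ip_hilbert.
  (* The quasi-basis of the fibre mean supplies the dual basis that makes C(Y) projective. *)
  have [E [Eexp _ _ Efin]] := covering_exp p_cov.
  have [n [u [al ual]]] := index_finite_dual_basis p_dual Eexp Efin.
  exact: dual_basis_fin_gen_projective ual.
(* The passage from 2 to 3 goes through 1: a dual basis yields the covering, whose fibre mean is the
   expectation. *)
- move=> [_ fgp]; apply/covering_exp/dual_basis_covering.
  exact: fin_gen_projective_dual_basis.
- move=> [E [Eexp _ _ Efin]].
  exact: dual_basis_covering (index_finite_dual_basis p_dual Eexp Efin).
Qed.
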